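(* (1) Assume the continuum hypothesis $\mathsf{CH}$. Then there is an inseparable sequence $\mathcal{A}=\langle A_\alpha \mid \alpha\in\omega_1\rangle$ of pairwise almost disjoint subsets of $\omega$ which contains no Lusin subsequence; that is, there is no uncountable $I\subseteq\omega_1$ such that $\langle A_i \mid i\in I\rangle$ is a Lusin sequence. (2) Assume Martin's Axiom together with $\neg\mathsf{CH}$. Then every inseparable sequence $\mathcal{A}=\langle A_\zeta \mid \zeta\in\omega_1\rangle$ of pairwise almost disjoint subsets of $\omega$ is a countable union of Lusin* subsequences; that is, there are countably many sets $I_k\subseteq\omega_1$ ($k\in\omega$) with $\bigcup_k I_k=\omega_1$ such that each $\langle A_i\mid i\in I_k\rangle$ is a Lusin* sequence.
   Context: For $A,B\subseteq\omega$, $A\subseteq^* B$ means $A\setminus B$ is finite, and $A\perp B$ (almost disjoint) means $A\cap B$ is finite. Each natural number $n$ is identified with $\{0,\dots,n-1\}$. A sequence $\mathcal{A}=\langle A_\zeta\mid\zeta\in\omega_1\rangle$ of subsets of $\omega$ is pairwise almost disjoint if $A_{\zeta_1}\perp A_{\zeta_2}$ for $\zeta_1\neq\zeta_2$. Such a sequence is inseparable if there is no $B\subseteq\omega$ such that both $\{\zeta : A_\zeta\subseteq^* B\}$ and $\{\zeta : A_\zeta\subseteq^*\omega\setminus B\}$ are uncountable. For $I\subseteq\omega_1$, the subsequence $\langle A_i\mid i\in I\rangle$ is a Lusin sequence if for every $i\in I$ and $n\in\omega$ the set $\{j\in I\cap i : A_i\cap A_j\subseteq n\}$ is finite; it is a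 Lusin* sequence if for every $i\in I$ and $n\in\omega$ the set $\{j\in I\cap i : |A_i\cap A_j|<n\}$ is finite. *)

(* Defs.v *)
(* [nat] plays omega, [set nat] its power set, and [`I_n] the natural number
   [n = {0, ..., n-1}]. *)
From HB Require Import structures.
From mathcomp Require Import all_boot all_order.
From mathcomp Require Import all_classical.
From mathcomp Require wochoice.

Set Implicit Arguments.
Unset Strict Implicit.
Unset Printing Implicit Defensive.

Import Order.TTheory.
Local Open Scope classical_set_scope.
Local Open Scope card_scope.
Local Open Scope order_scope.

(* Strict inequality of cardinals; by comparability of cardinals,
   [~~ (B #<= A)] alone would say the same. *)
Definition card_lt T U (A : set T) (B : set U) : Prop :=
  A #<= B /\ ~ (B #<= A).

(* [W] has the order type of omega_1: it is an uncountable well-order all of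
   whose proper initial segments are countable. This determines [W] up to a
   unique isomorphism. *)
Definition is_omega1 d (W : orderType d) : Prop :=
  [/\ wochoice.well_order (<=%O : rel W),
      forall i : W, countable [set j | j < i]
    & ~ countable [set: W]].

Definition CH : Prop :=
  forall S : set (set nat), countable S \/ S #= [set: set nat].

Section Posets.
Context d (P : porderType d).
Implicit Types (p q r : P) (D G : set P).

(* A stronger forcing condition is a smaller element. *)
Definition compatible p q : Prop := exists r, r <= p /\ r <= q.

Definition antichain D : Prop :=
  forall p q, D p -> D q -> p <> q -> ~ compatible p q.

Definition ccc : Prop := forall D, antichain D -> countable D.

Definition poset_dense D : Prop := forall p, exists2 q, D q & q <= p.

Definition poset_filter G : Prop :=
  [/\ G !=set0,
      forall p q, G p -> p <= q -> G q
    & forall p q, G p -> G q -> exists2 r, G r & r <= p /\ r <= q].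

End Posets.

Definition MartinAxiom : Prop :=
  forall d (P : porderType d), [set: P] !=set0 -> ccc P ->
  forall F : set (set P), card_lt F [set: set nat] ->
    (forall D, F D -> poset_dense D) ->
  exists2 G, poset_filter G & forall D, F D -> G `&` D !=set0.

Definition almost_subset (A B : set nat) : Prop := finite_set (A `\` B).

Definition almost_disjoint (A B : set nat) : Prop := finite_set (A `&` B).

Section Sequences.
Context d (W : orderType d).
Implicit Types (A : W -> set nat) (I : set W).

Definition pairwise_almost_disjoint A : Prop :=
  forall i j, i <> j -> almost_disjoint (A i) (A j).

Definition inseparable A : Prop :=
  ~ exists B : set nat,
      ~ countable [set i | almost_subset (A i) B] /\
      ~ countable [set i | almost_subset (A i) (~` B)].

Definition lusin A I : Prop :=
  forall i, I i -> forall n : nat,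
    finite_set [set j | [/\ I j, j < i & A i `&` A j `<=` `I_n]].

Definition lusin_star A I : Prop :=
  forall i, I i -> forall n : nat,
    finite_set [set j | [/\ I j, j < i & card_lt (A i `&` A j) `I_n]].

End Sequences.

(* Main.v *)
(* (1) Build the [A i] by recursion, each almost disjoint from the previous ones
   and from countably many fixed infinite disjoint sets. By CH, the sets [B] and
   the sequences of sets are listed in type omega_1. At stage [i], [A i] is made
   to have an infinite intersection with each listed [B] that is not almost
   covered by finitely many previous sets, which gives inseparability; for each
   listed sequence of previous [A j]'s converging to a previous [A j0], [A i] is
   made to have uniformly bounded intersections with infinitely many of its
   terms. An uncountable [I] contains a [j0] and a sequence of indices [j] with
   [A j] converging to [A j0], since only countably many points of a set of reals
   are not condensation points; hence [I] is not Lusin.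

   (2) Force with finite sets [s] of pairs (index, colour) together with a promise
   [n]: whenever [j < i] have the same colour, [i] is in [s] and [j] is added
   later, [A i `&` A j] has at least [n] elements. Inseparability yields the
   countable chain condition, without Martin's axiom. In an uncountable family of
   conditions with a common root, call a finite amount of information on the sets
   [A i] large if uncountably many conditions satisfy it. Given large information,
   the points that can be added to it at a given position form a set that almost
   contains uncountably many [A i]; so all but countably many [A i] meet this set
   in an infinite set. Hence the information can be enlarged, [n] points at a
   time, until it forces all the intersections required by the promise. *)
Require Import Defs.
From HB Require Import structures.
From mathcomp Require Import all_boot all_order finmap.
From mathcomp Require Import all_classical.

Set Implicit Arguments.
Unset Strict Implicit.
Unset Printing Implicit Defensive.

Import Order.TTheory.
Local Open Scope order_scope.
Local Open Scope classical_set_scope.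
Local Open Scope card_scope.

(** * Infinite and countable sets, well-founded recursion *)

Lemma infinite_natP (X : set nat) :
  infinite_set X <-> forall L, exists2 m, (L <= m)%N & X m.
Proof.
split=> [Xinf L|Xub /finite_seqP[s Xs]].
  apply: contrapT => Xb; apply: Xinf.
  apply: sub_finite_set (finite_II L) => m Xm /=.
  by rewrite ltnNge; apply/negP => Lm; apply: Xb; exists m.
have [m] := Xub (\max_(i <- s) i).+1; rewrite Xs /= => ltm sm.
by have := @leq_bigmax_seq _ s xpredT id m sm isT; rewrite leqNgt ltm.
Qed.

Lemma finite_nat_bounded (X : set nat) : finite_set X -> exists n, X `<=` `I_n.
Proof.
move=> /finite_seqP[s ->]; exists (\max_(i <- s) i).+1 => m sm /=.
exact: (@leq_bigmax_seq _ s xpredT id m sm isT).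
Qed.

Lemma countable_range T (E : set T) :
  countable E -> E !=set0 -> exists e : nat -> T, range e = E.
Proof.
move=> /pfcard_geP[->|[e] _]; first by case.
by exists e; apply: image_eq.
Qed.

Lemma countable_setU T (A B : set T) :
  countable A -> countable B -> countable (A `|` B).
Proof.
move=> Ac Bc; rewrite -bigcup2E; apply: bigcup_countable => // -[|[|n]] _ //=.
Qed.

Lemma uncountable_setD T (S C : set T) :
  ~ countable S -> countable C -> ~ countable (S `\` C).
Proof.
move=> Sunc Cc SC; apply: Sunc.
apply: (@sub_countable _ _ _ ((S `\` C) `|` C)); last exact: countable_setU.
by apply: subset_card_le => x Sx; have [Cx|nCx] := pselect (C x); [right|left].
Qed.

Lemma uncountable_nonempty T (S : set T) : ~ countable S -> S !=set0.
Proof. by move=> Sunc; apply/set0P/negP => /eqP S0; apply: Sunc; rewrite S0. Qed.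

Lemma countable_image T U (f : T -> U) (S : set T) :
  countable S -> countable (f @` S).
Proof. exact/sub_countable/card_image_le. Qed.

Lemma finite_set_inj_image T U (f : T -> U) (S : set T) :
  injective f -> finite_set (f @` S) -> finite_set S.
Proof.
move=> finj; rewrite (@eq_finite_set _ _ (f @` S) S)//.
by apply: inj_card_eq => x y _ _; apply: finj.
Qed.

(** The step [G] sees only the set of earlier values, which does not depend on the proofs of
    [R j i]; the recursion equation can then be stated without them. *)
Lemma wf_image_rec (W T : Type) (R : W -> W -> Prop) (wfR : well_founded R)
    (G : W -> set T -> T) :
  exists A : W -> T, forall i, A i = G i (A @` [set j | R j i]).
Proof.
pose F i (rec : forall j, R j i -> T) : T :=
  G i [set x | exists j (Rji : R j i), rec j Rji = x].
exists (Fix wfR (fun=> T) F) => i.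
rewrite Fix_eq => [|j f g fg]; last first.
  congr G; apply/seteqP; split=> x [k [Rkj <-]]; exists k, Rkj; rewrite fg//.
congr G; apply/seteqP; split=> x.
  by move=> [j [Rji <-]]; exists j.
by move=> [j Rji <-]; exists j, Rji.
Qed.

(** By recursion, [f l] avoids the finitely many earlier values. *)
Lemma injective_choice T (X : nat -> set T) : (forall l, infinite_set (X l)) ->
  exists2 f : nat -> T, injective f & forall l, X l (f l).
Proof.
move=> Xinf; have [x0 _] := infinite_setN0 (Xinf 0).
have [g gP] := @choice (nat * set T) T
  (fun p x => finite_set p.2 -> (X p.1 `\` p.2) x) (fun p =>
   match pselect (finite_set p.2) with
   | left fin => let: ex_intro x xP := infinite_setN0 (infinite_setD (Xinf p.1) fin)
                 in ex_intro _ x (fun=> xP)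
   | right nfin => ex_intro _ x0 (fun fin => False_ind _ (nfin fin))
   end).
have ltn_wf : well_founded (fun i j => (i < j)%N).
  by move=> n; elim/ltn_ind: n => n IH; constructor.
have [f fE] := wf_image_rec ltn_wf (fun l Y => g (l, Y)).
have fP l : (X l `\` f @` `I_l) (f l).
  by rewrite fE; apply: (gP (l, _)); apply/finite_image/finite_II.
exists f => [|l]; last by case: (fP l).
have lt_neq i j : (i < j)%N -> f i <> f j.
  by move=> ij fij; case: (fP j) => _; apply; exists i.
move=> i j fij; case: (ltngtP i j) => // /lt_neq; last by move/(_ (esym fij)).
by move/(_ fij).
Qed.

(** * Generic sets for countably many tasks *)

(** Schedules tasks: if stage [t] serves task [logn 2 t], every task recurs at arbitrarily late
    stages. *)
Lemma logn2_cofinal k L : exists2 t, (L <= t)%N & logn 2 t = k.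
Proof.
exists (2 ^ k * 3 ^ L)%N; last first.
  by rewrite lognM ?expn_gt0// pfactorK// lognX muln0 addn0.
by rewrite (leq_trans (ltnW (ltn_expl L (isT : 1 < 3)%N)))// leq_pmull// expn_gt0.
Qed.

(* [b] is positive for the ideal generated by [E] and the finite sets. *)
Definition positive (E : set (set nat)) (b : set nat) : Prop :=
  forall F : seq (set nat), (forall e, e \in F -> E e) ->
    infinite_set [set m | b m /\ forall e, e \in F -> ~ e m].

(** The members of [F] remove only finitely many points of [x]. *)
Lemma almost_subset_positive (E : set (set nat)) (b : set nat) :
  (forall F : seq (set nat), (forall e, e \in F -> E e) ->
    exists x, [/\ infinite_set x, almost_subset x b
      & forall e, e \in F -> almost_disjoint x e]) ->
  positive E b.
Proof.
move=> Eb F FE fin; have [x [xinf xb xF]] := Eb F FE; apply: xinf.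
have xFfin : finite_set (\bigcup_(e in [set` F]) (x `&` e)).
  by apply: bigcup_finite => //; exact: finite_seq.
apply: (@sub_finite_set _ _ ((x `\` b) `|` ([set m | b m /\
    forall e, e \in F -> ~ e m] `|` \bigcup_(e in [set` F]) (x `&` e)))).
  move=> m xm; have [bm|nbm] := pselect (b m); last by left.
  right; have [[e eF em]|neF] := pselect (exists2 e, e \in F & e m).
    by right; exists e.
  by left; split=> // e eF em; apply: neF; exists e.
by rewrite !finite_setU.
Qed.

(* Each [c] in [C] is used both for the set [c 0] and as a sequence of sets
   [c l.+1] with putative limit [c 0].
   [A] grows by finite stages [p t]: points [(p t).1] and a list [(p t).2] of
   (indices of) members of [E] which receive no further points. For a sequence
   [c] with [limsup c l.+1] included in [c 0], the points chosen so far that lie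
   outside [c 0] are eventually outside [c l.+1], so that one can freeze some
   [c l.+1] with [A `&` c l.+1 `<=` A `&` c 0]; the bound [n] is then any bound
   of the finite set [A `&` c 0]. *)
Lemma generic_set (E : set (set nat)) (C : set (nat -> set nat)) :
  countable E -> E !=set0 -> countable C -> C !=set0 ->
  exists A : set nat,
    [/\ forall e, E e -> finite_set (A `&` e),
        forall c, C c -> positive E (c 0) -> infinite_set (A `&` c 0)
      & forall c, C c -> (forall l, E (c l)) ->
          (forall m, exists L, forall l, (L <= l)%N -> c l.+1 m -> c 0 m) ->
          exists n, forall L, exists2 l, (L <= l)%N & A `&` c l.+1 `<=` `I_n].
Proof.
move=> + + + +; move=> /countable_range /[apply] -[e rE].
move=> /countable_range /[apply] -[c rC].
pose conv k := (forall l, E (c k l)) /\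
  forall m, exists L, forall l, (L <= l)%N -> c k l.+1 m -> c k 0 m.
(* Freezing [e t] at stage [t], whatever the task, makes [A] almost disjoint from every member of
   [E]. *)
pose step (tp : nat * (seq nat * seq nat)) (q : seq nat * seq nat) :=
  let: (t, p) := tp in let k := logn 2 t in
  [/\ {subset p.1 <= q.1}, {subset t :: p.2 <= q.2},
      forall m, m \in q.1 -> m \in p.1 \/ forall i, i \in p.2 -> ~ e i m,
      positive E (c k 0) -> exists m, [/\ m \in q.1, (t <= m)%N & c k 0 m]
    & conv k -> exists i l, [/\ i \in q.2, (t <= l)%N, e i = c k l.+1
      & forall m, m \in q.1 -> e i m -> c k 0 m]].
have stepE tp : exists q, step tp q.
  case: tp => t [a F]; set k := logn 2 t.
  have [a' [aa' a'F a'c]] : exists a' : seq nat, [/\ {subset a <= a'},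
      forall m, m \in a' -> m \in a \/ forall i, i \in F -> ~ e i m
    & positive E (c k 0) -> exists m, [/\ m \in a', (t <= m)%N & c k 0 m]].
    have [pos|npos] := pselect (positive E (c k 0)); last first.
      by exists a; split=> // m ma; left.
    have /infinite_natP/(_ t)[m tm [cm Fm]] : infinite_set
        [set m | c k 0 m /\ forall x, x \in map e F -> ~ x m].
      by apply: pos => x /mapP[i _ ->]; rewrite -rE; exists i.
    exists (m :: a); split=> [x xa|x|_]; first by rewrite inE xa orbT.
      rewrite inE => /predU1P[->|]; last by left.
      by right=> i iF; apply/Fm/map_f.
    by exists m; rewrite inE eqxx.
  have [cv|ncv] := pselect (conv k); last first.
    by exists (a', t :: F); split.
  have [L tL aL] : exists2 L, (t <= L)%N & forall m, m \in a' -> c k L.+1 m -> c k 0 m.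
    suff [L aL] : exists L, forall l, (L <= l)%N ->
        forall m, m \in a' -> c k l.+1 m -> c k 0 m.
      by exists (maxn t L); [rewrite leq_maxl|apply/aL; rewrite leq_maxr].
    case: cv => _ cv; elim: (a') => [|m b [L IH]]; first by exists 0.
    have [L' L'm] := cv m; exists (maxn L L') => l; rewrite geq_max => /andP[Ll L'l] x.
    by rewrite inE => /predU1P[->|/IH]; [apply: L'm|apply].
  have [i _ ei] : range e (c k L.+1) by rewrite rE; case: cv.
  exists (a', i :: t :: F); split=> // [x xF|_]; first by rewrite inE xF orbT.
  by exists i, L; split=> //; [rewrite inE eqxx|rewrite ei].
have [nxt nxtP] := choice stepE.
pose p t := iteri t (fun t p => nxt (t, p)) ([::], [::]).
have pS t : step (t, p t) (p t.+1) by exact: nxtP.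
have mono t t' : (t <= t')%N ->
    {subset (p t).1 <= (p t').1} /\ {subset (p t).2 <= (p t').2}.
  move=> /subnK <-; elim: (t' - t)%N => [|d [IH1 IH2]].
    by split=> x; rewrite add0n.
  rewrite addSn; have [S1 S2 _ _ _] := pS (d + t)%N.
  by split=> x xp; [apply/S1/IH1|apply/S2; rewrite inE IH2// orbT].
pose A := [set m | exists t, m \in (p t).1].
have frozen t i m : i \in (p t).2 -> A m -> e i m -> m \in (p t).1.
  move=> it [t' mt'] im; have [/mono[+ _]|/ltnW tt'] := leqP t' t; first exact.
  move: mt'; rewrite -(subnK tt'); elim: (t' - t)%N => [|d IH]; first by rewrite add0n.
  rewrite addSn; have [_ _ S3 _ _] := pS (d + t)%N => /S3[/IH//|S3m].
  by case: (S3m i _ im); apply: (mono t (d + t)%N (leq_addl _ _)).2.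
have finE x : E x -> finite_set (A `&` x).
  rewrite -rE => -[i _ <-]; apply: sub_finite_set (finite_seq (p i.+1).1).
  move=> m [Am im]; apply: frozen Am im.
  by case: (pS i) => _ + _ _ _; apply; rewrite inE eqxx.
exists A; split=> // x; rewrite -{1}rC => -[k _ <-] {x}.
  move=> pos; apply/infinite_natP => L.
  have [t Lt tk] := logn2_cofinal k L.
  case: (pS t) => _ _ _ + _; rewrite tk => /(_ pos)[m [mp tm cm]].
  by exists m; [exact: leq_trans tm|split=> //; exists t.+1].
move=> cE ccv; have cv : conv k by split.
have [n An] := finite_nat_bounded (finE _ (cE 0)).
exists n => L; have [t Lt tk] := logn2_cofinal k L.
case: (pS t) => _ _ _ _; rewrite tk => /(_ cv)[i [l [ip tl ei im]]].
exists l; first exact: leq_trans tl.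
rewrite -ei => m [Am eim]; apply: An; split=> //.
exact: im (frozen _ _ _ ip Am eim) eim.
Qed.

(** * The order type omega_1 and enumerations under CH *)

Section Omega1.
Context d (W : orderType d) (W_omega1 : is_omega1 W).

Lemma omega1_wf : well_founded (fun j i : W => j < i).
Proof.
move=> x; apply: contrapT => nx; case: W_omega1 => wo _ _.
have [|z [[zA zmin] _]] := wo [pred y | `[< ~ Acc (fun j i : W => j < i) y >]].
  by exists x; apply/asboolP.
move/asboolP: zA; apply; constructor => y yz; apply: contrapT => ny.
suff /le_lt_trans/(_ yz) : z <= y by rewrite ltxx.
by apply: zmin; apply/asboolP.
Qed.

Lemma countable_below (C : set W) :
  countable C -> countable [set i | exists2 c, C c & i <= c].
Proof.
move=> Cc; case: W_omega1 => _ seg _.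
have : countable (\bigcup_(c in C) ([set j | j < c] `|` [set c])).
  apply: bigcup_countable => // c _.
  by apply: countable_setU; [exact: seg|exact: countable1].
apply/sub_countable/subset_card_le => i [c Cc' ic]; exists c => //=.
by move: ic; rewrite le_eqVlt => /predU1P[->|]; [right|left].
Qed.

Lemma uncountable_above (I C : set W) : ~ countable I -> countable C ->
  exists2 i, I i & forall c, C c -> c < i.
Proof.
move=> Iunc /countable_below Cc.
have [i [Ii nC]] := uncountable_nonempty (uncountable_setD Iunc Cc).
by exists i => // c Cc'; rewrite ltNge; apply/negP => ic; apply: nC; exists c.
Qed.

(** Transfinite recursion picks [h i] in [S] outside the countably many earlier values; [h] is an
    injection. *)
Lemma omega1_card_le T (S : set T) : ~ countable S -> [set: W] #<= S.
Proof.
move=> Sunc; have [x0 _] := uncountable_nonempty Sunc.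
have [g gP] : {g : set T -> T & forall X, S `\` X !=set0 -> (S `\` X) (g X)}.
  apply: (@choice (set T) T (fun X x => S `\` X !=set0 -> (S `\` X) x)) => X.
  have [[x SXx]|SX0] := pselect (S `\` X !=set0).
    by exists x.
  by exists x0.
have [h hE] := wf_image_rec omega1_wf (fun=> g).
have hP i : (S `\` h @` [set j | j < i]) (h i).
  rewrite hE; apply: (gP (h @` [set j | j < i])); apply: uncountable_nonempty.
  by apply: uncountable_setD => //; apply: countable_image; case: W_omega1.
have hinj : injective h.
  move=> i j hij; apply/eqP; rewrite eq_le !leNgt; apply/andP; split; apply/negP => ij.
    by case: (hP i) => _; apply; exists j.
  by case: (hP j) => _; apply; exists i.
rewrite -(@card_le_eql _ _ _ (h @` setT)); last first.
  by apply: inj_card_eq => i j _ _; apply: hinj.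
by apply: subset_card_le => _ [i _ <-]; case: (hP i).
Qed.

Lemma uncountable_set_nat : ~ countable [set: set nat].
Proof.
move=> /pfcard_geP[/seteqP[+ _]|[f]]; first by move=> /(_ set0 I).
have [n _ fn] : range f (fun n => ~ f n n) by rewrite (image_eq f).
by have [nn|nn] := pselect (f n n); move: (nn); rewrite {1}fn.
Qed.

(** An injection of omega_1 into the continuum has uncountable range, which CH makes equipotent to
    the continuum. A sequence of sets is coded by one set of codes of pairs. *)
Lemma CH_enum : CH -> exists c : W -> nat -> set nat, range c = setT.
Proof.
move=> ch.
have [_ _ Wunc] := W_omega1.
have /pcard_leTP[g] := omega1_card_le uncountable_set_nat.
have [/(sub_countable _) gc|] := ch (range g).
  by case: Wunc; apply: gc; rewrite -(card_le_eql (card_image g)).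
rewrite card_eq_sym (card_eqr (card_image g)) card_eq_le => /andP[+ _].
move=> /pfcard_geP[/seteqP[+ _]|[f]]; first by move=> /(_ set0 I).
exists (fun w n => [set m | f w (choice.pickle (n, m))]).
apply/seteqP; split=> // c _.
have [w _ fw] : range f [set x | exists2 nm : nat * nat,
    choice.pickle nm = x & c nm.1 nm.2] by rewrite (image_eq f).
exists w => //; apply: funext => n; apply/seteqP; split=> m /=; rewrite fw /=.
  by move=> [[n' m'] /(pcan_inj choice.pickleK)[-> ->]].
by exists (n, m).
Qed.

End Omega1.

(** * An inseparable sequence without Lusin subsequences *)

Section Omega1CH.
Context d (W : orderType d) (W_omega1 : is_omega1 W).

Theorem CH_inseparable_no_lusin : CH ->
  exists A : W -> set nat,
    [/\ pairwise_almost_disjoint A,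
        inseparable A
      & ~ exists I : set W, ~ countable I /\ lusin A I].
Proof.
move=> /(CH_enum W_omega1)[c rc].
(* These disjoint sets join every ideal: a finite list of members omits some [col k], which is
   almost disjoint from all its entries, so [setT] is positive at each stage. *)
pose col k := [set m | logn 2 m = k].
have col_inf k : infinite_set (col k).
  by apply/infinite_natP => L; have [t Lt tk] := logn2_cofinal k L; exists t.
have col_inj : injective col.
  move=> k l kl; have [t _ tk] := logn2_cofinal k 0.
  by have : col k t by []; rewrite kl => <-.
pose E X := range col `|` X.
(* The task [fun=> setT] makes each [A w] infinite. *)
pose Cs w := c @` [set v | v < w] `|` [set fun=> setT].
pose spec w X A :=
  [/\ forall e, E X e -> finite_set (A `&` e),
      forall c, Cs w c -> positive (E X) (c 0) -> infinite_set (A `&` c 0)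
    & forall c, Cs w c -> (forall l, E X (c l)) ->
        (forall m, exists L, forall l, (L <= l)%N -> c l.+1 m -> c 0 m) ->
        exists n, forall L, exists2 l, (L <= l)%N & A `&` c l.+1 `<=` `I_n].
have [_ seg _] := W_omega1.
have [G GP] : exists G, forall p : W * set (set nat),
    countable p.2 -> spec p.1 p.2 (G p).
  have [|G GP] := @choice (W * set (set nat)) (set nat)
      (fun p A => countable p.2 -> spec p.1 p.2 A); last by exists G.
  move=> [w X]; have [Xc|nXc] := pselect (countable X); last by exists set0.
  have [|||| A AP] := @generic_set (E X) (Cs w).
  - by apply: countable_setU => //; apply: countable_image.
  - by exists (col 0); left; exists 0.
  - by apply: countable_setU => //; exact: countable_image.
  - by exists (fun=> setT); right.
  - by exists A => _.
have [A AE] := wf_image_rec (omega1_wf W_omega1) (fun w X => G (w, X)).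
have {AE GP}AP w : spec w (A @` [set v | v < w]) (A w).
  by rewrite AE; apply: (GP (w, _)); apply: countable_image.
have A_col w k : almost_disjoint (A w) (col k).
  by case: (AP w) => + _ _; apply; left; exists k.
have A_ad : pairwise_almost_disjoint A.
  suff H i j : j < i -> almost_disjoint (A i) (A j).
    move=> i j /eqP; rewrite neq_lt => /orP[/H|/H//].
    by rewrite /almost_disjoint setIC.
  by move=> ji; case: (AP i) => + _ _; apply; right; exists j.
have A_inf w : infinite_set (A w).
  case: (AP w) => _ /(_ (fun=> setT)) + _; rewrite /= setIT; apply; first by right.
  apply: almost_subset_positive => F FE.
  have [k kF] : exists k, col k \notin F.
    apply: contrapT => allF; apply: infinite_nat.
    apply: (finite_set_inj_image col_inj).
    apply: sub_finite_set (finite_seq F) => _ [k _ <-] /=.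
    by apply/negPn/negP => kF; apply: allF; exists k.
  exists (col k); split=> // [|e eF].
    by rewrite /almost_subset setDT; exact: finite_set0.
  rewrite /almost_disjoint setIC.
  case: (FE e eF) => [[l _ le]|[v _ <-]]; last exact: A_col.
  have -> : e `&` col k = set0; last exact: finite_set0.
  apply/seteqP; split=> // m []; rewrite -le => lm km.
  by move: eF kF; rewrite -le -lm -km => ->.
have A_inj : injective A.
  move=> i j Aij; apply: contrapT => /A_ad; rewrite /almost_disjoint -Aij setIid.
  exact: A_inf.
exists A; split=> //.
  move=> [B [Xunc Yunc]]; set X := [set i | almost_subset (A i) B] in Xunc.
  have [f finj fX] : exists2 f : nat -> W, injective f & forall n, X (f n).
    by apply: (injective_choice (X := fun=> X)) => _ /finite_set_countable.
  have [b _ bB] : range c (fun=> B) by rewrite rc.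
  (* At stage [a], [B] is already listed, and positive because of the infinitely many earlier
     [A (f n)] almost inside it. So [A a] meets [B] in an infinite set, although [a] is in the
     second class. *)
  have [|a aY aC] := uncountable_above W_omega1 Yunc
    (C := range (fun n => if n is n'.+1 then f n' else b)).
    by apply: countable_image.
  have fa n : f n < a by apply: aC; exists n.+1.
  have ba : b < a by apply: aC; exists 0.
  case: (AP a) => _ /(_ (fun=> B)) + _.
  case; [by left; exists b| |]; last first.
    by apply: sub_finite_set aY => m [Am Bm]; split=> // /(_ Bm).
  apply: almost_subset_positive => F FE.
  have [n nF] : exists n, A (f n) \notin F.
    apply: contrapT => allF; apply: infinite_nat.
    apply: (finite_set_inj_image (inj_comp A_inj finj)).
    apply: sub_finite_set (finite_seq F) => _ [k _ <-] /=.
    by apply/negPn/negP => kF; apply: allF; exists k.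
  exists (A (f n)); split=> // [|e eF]; first exact: fX.
  case: (FE e eF) => [[l _ <-]|[v _ ve]]; first exact: A_col.
  rewrite -ve; apply: A_ad => fnv.
  by move: eF nF; rewrite fnv ve => ->.
move=> [I [Iunc Ilus]].
pose N L (s : seq nat) :=
  [set j | I j /\ forall m, (m < L)%N -> A j m <-> m \in s].
have [j0 [Ij0 Nj0]] : exists j0, I j0 /\ forall L s, N L s j0 -> ~ countable (N L s).
  (* The points of [I] that are not condensation points; there are only countably many pairs
     [(L, s)]. *)
  pose Z := \bigcup_(p in [set p : nat * seq nat | countable (N p.1 p.2)]) N p.1 p.2.
  have Zc : countable Z by apply: bigcup_countable.
  have [j0 [Ij0 nZ]] := uncountable_nonempty (uncountable_setD Iunc Zc).
  by exists j0; split=> // L s Nj Nc; apply: nZ; exists (L, s).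
(* Of the convergence to [A j0], only the half that [spec] requires is kept. *)
have [f finj fN] : exists2 f : nat -> W, injective f & forall l,
    I (f l) /\ forall m, (m < l)%N -> A (f l) m -> A j0 m.
  apply: (injective_choice (X := fun l => [set j | I j /\
    forall m, (m < l)%N -> A j m -> A j0 m])) => l /finite_set_countable.
  pose s := [seq m <- iota 0 l | `[< A j0 m >]].
  have sP m : (m < l)%N -> A j0 m <-> m \in s.
    move=> ml; rewrite mem_filter mem_iota /= add0n ml andbT.
    by split=> [/asboolP|/asboolP].
  apply: contra_not (Nj0 l s _) => //.
  apply/sub_countable/subset_card_le => j [Ij jN]; split=> // m ml.
  by rewrite jN// -sP.
have [b _ bE] : range c (fun l => if l is l'.+1 then A (f l') else A j0) by rewrite rc.
have [|a aI aC] := uncountable_above W_omega1 Iunc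
  (C := range (fun n => if n is n'.+2 then f n' else if n is 1 then j0 else b)).
  by apply: countable_image.
have fa n : f n < a by apply: aC; exists n.+2.
have ja : j0 < a by apply: aC; exists 1.
have ba : b < a by apply: aC; exists 0.
case: (AP a) => _ _ /(_ (c b)); case.
- by left; exists b.
- by rewrite bE => l; right; case: l => [|l]; apply: imageP; [exact: ja|exact: fa].
- by rewrite bE => m; exists m.+1 => l ml; apply: (fN l).2.
rewrite bE => n /infinite_natP; apply.
apply: (finite_set_inj_image finj); apply: sub_finite_set (Ilus a aI n).
by move=> _ [l Al <-]; split=> //; case: (fN l).
Qed.

End Omega1CH.

(** * Roots and large intersections in uncountable families *)

Lemma uncountable_fiber T (X : countType) (f : T -> X) (S : set T) :
  ~ countable S -> exists x, ~ countable [set p | S p /\ f p = x].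
Proof.
move=> Sunc; apply: contrapT => fib; apply: Sunc.
have : countable (\bigcup_(x in [set: X]) [set p | S p /\ f p = x]).
  apply: bigcup_countable => // x _.
  by apply: contrapT => xunc; apply: fib; exists x.
by apply/sub_countable/subset_card_le => p Sp; exists (f p).
Qed.

Lemma uniq_card_le (s : seq nat) (X : set nat) :
  uniq s -> (forall m, m \in s -> X m) -> `I_(size s) #<= X.
Proof.
move=> us sX.
have nth_inj : {in `I_(size s) &, injective (nth 0 s)}.
  move=> i j; rewrite !inE /= => si sj /eqP.
  by rewrite nth_uniq// => /eqP.
rewrite -(card_le_eql (inj_card_eq nth_inj)).
by apply: subset_card_le => _ [i si <-]; apply/sX/mem_nth.
Qed.

(* Plays the part of the Delta-system lemma: past a maximal root, each point
   lies in only countably many members of the family. *)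
Lemma maximal_root T (S : set T) (X : choiceType) (f : T -> {fset X}) (k : nat) :
  ~ countable S -> (forall p, S p -> #|` f p| = k) ->
  exists R : {fset X}, ~ countable [set p | S p /\ (R `<=` f p)%fset] /\
    forall x, x \notin R -> countable [set p | [/\ S p, (R `<=` f p)%fset & x \in f p]].
Proof.
move=> Sunc Sk; apply: contrapT => nR.
(* Otherwise roots grow one point at a time up to [k.+1] points, more than any [f p] has. *)
have [R [Rk Runc]] : exists R : {fset X}, #|` R| = k.+1 /\
    ~ countable [set p | S p /\ (R `<=` f p)%fset].
  elim: k.+1 => [|r [R [Rr Runc]]].
    exists fset0; split; first exact: cardfs0.
    apply: contra_not Sunc; apply/sub_countable/subset_card_le => p Sp.
    by split=> //; exact: fsub0set.
  have [x [xR xunc]] : exists x, x \notin R /\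
      ~ countable [set p | [/\ S p, (R `<=` f p)%fset & x \in f p]].
    apply: contrapT => nx; apply: nR; exists R; split=> // x xR.
    by apply: contrapT => xunc; apply: nx; exists x.
  exists (x |` R)%fset; split; first by rewrite cardfsU1 xR Rr.
  apply: contra_not xunc; apply/sub_countable/subset_card_le => p [Sp Rp xp].
  by split=> //; rewrite fsubUset fsub1set xp.
have [p [Sp /fsubset_leq_card]] := uncountable_nonempty Runc.
by rewrite Rk Sk// ltnn.
Qed.

Section LargeIntersections.
Context d (W : orderType d) (A : W -> set nat) (A_insep : inseparable A).
Context (T : Type) (F : set T) (k : nat) (x : nat -> T -> W).
Hypothesis x_ctbl : forall w, countable [set p | F p /\ exists2 l, (l < k)%N & x l p = w].

(* Only positive information is kept: [(l, m) \in O] says that [m] belongs to the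
   set indexed by the [l]-th coordinate. *)
Let S (O : seq (nat * nat)) := [set p | F p /\ forall o, o \in O -> A (x o.1 p) o.2].
Let U O l := [set m | ~ countable (S ((l, m) :: O))].

Let x_ctbl_in (Y : set W) l : (l < k)%N -> countable Y -> countable [set p | F p /\ Y (x l p)].
Proof.
move=> lk Yc.
have : countable (\bigcup_(w in Y) [set p | F p /\ exists2 l, (l < k)%N & x l p = w]).
  exact: bigcup_countable.
by apply/sub_countable/subset_card_le => p [Fp Yp]; exists (x l p) => //; split=> //; exists l.
Qed.

(** All but countably many [p] in [S O] have [A (x l p)] inside [U O l], and each index occurs for
    countably many [p]. So [U O l] contains uncountably many [A i], and inseparability applies. *)
Let small_ctbl O l : ~ countable (S O) -> (l < k)%N ->
  countable [set i | finite_set (A i `&` U O l)].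
Proof.
move=> SO lk; apply: contrapT => Yunc; apply: A_insep; exists (U O l); split; last first.
  apply: contra_not Yunc; apply/sub_countable/subset_card_le => i.
  by apply: sub_finite_set => m [Am /contrapT].
pose N := \bigcup_(m in ~` U O l) S ((l, m) :: O).
have Nc : countable N by apply: bigcup_countable => // m /contrapT.
move=> Xc; apply: (uncountable_setD SO Nc).
apply: sub_countable (x_ctbl_in lk Xc); apply: subset_card_le => p [[Fp Op] nN].
split=> //; apply: (@sub_finite_set _ _ set0) => // m [Am nU]; apply: nN.
by exists m => //; split=> // o; rewrite inE => /predU1P[->|/Op].
Qed.

(** There are countably many finite lists [O], so one countable exceptional set [N] serves them
    all. *)
Lemma large_intersections n : ~ countable F -> exists2 N, countable N &
  forall p, F p -> ~ N p -> exists2 S', S' `<=` F & ~ countable S' /\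
    forall q l l', S' q -> (l < k)%N -> (l' < k)%N ->
      `I_n #<= A (x l p) `&` A (x l' q).
Proof.
move=> Func.
pose N := \bigcup_(a in [set a : seq (nat * nat) * nat * nat |
    [/\ ~ countable (S a.1.1), (a.1.2 < k)%N & (a.2 < k)%N]])
  [set p | F p /\ finite_set (A (x a.1.2 p) `&` U a.1.1 a.2)].
exists N.
  apply: bigcup_countable => // -[[O l] l'] [/= SO lk l'k].
  exact: (x_ctbl_in lk (small_ctbl SO l'k)).
move=> p Fp nN.
pose good (O : seq (nat * nat)) l l' := exists s : seq nat, [/\ uniq s, size s = n &
  forall m, m \in s -> A (x l p) m /\ (l', m) \in O].
have step O l l' : ~ countable (S O) -> (l < k)%N -> (l' < k)%N ->
    exists O', [/\ ~ countable (S O'), {subset O <= O'} & good O' l l'].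
  move=> SO lk l'k; rewrite /good {good}; elim: n => [|n' [O' [SO' OO' [s [us sn sO']]]]].
    by exists O; split=> //; exists [::].
  have Uinf : infinite_set (A (x l p) `&` U O' l').
    by move=> fin; apply: nN; exists (O', l, l').
  have [m [[Am Um] /= ms]] := infinite_setN0 (infinite_setD Uinf (finite_seq s)).
  exists ((l', m) :: O'); split=> // [o /OO' oO'|]; first by rewrite inE oO' orbT.
  exists (m :: s); split=> /=; [by apply/andP; split=> //; apply/negP|by rewrite sn|].
  move=> y; rewrite !inE => /predU1P[->|/sO'[Ay yO']]; first by rewrite eqxx.
  by rewrite yO' orbT.
have [O [SO Ogood]] : exists O, ~ countable (S O) /\
    forall a, a \in [seq (l, l') | l <- iota 0 k, l' <- iota 0 k] -> good O a.1 a.2.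
  have : all (fun a => (a.1 < k)%N && (a.2 < k)%N)
      [seq (l, l') | l <- iota 0 k, l' <- iota 0 k].
    by apply/allP => _ /allpairsP[[l l'] /= [+ + ->]]; rewrite !mem_iota /= => -> ->.
  elim: [seq _ | l <- _, l' <- _] => [_|[l l'] r IH /= /andP[/andP[lk l'k] /IH]].
    exists [::]; split=> //; apply: contra_not Func.
    by apply/sub_countable/subset_card_le => q Fq; split.
  move=> [O [SO Or]]; have [O' [SO' OO' gO']] := step O l l' SO lk l'k.
  exists O'; split=> // a; rewrite inE => /predU1P[->//|/Or[s [us sn sO]]].
  by exists s; split=> // m /sO[Am /OO'].
exists (S O) => [q []//|]; split=> // q l l' [Fq Oq] lk l'k.
have [|s [us <- sO]] := Ogood (l, l').
  by apply/allpairsP; exists (l, l'); rewrite !mem_iota.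
by apply: uniq_card_le => // m /sO[Am /Oq].
Qed.

End LargeIntersections.

(* The pairs (index, colour) need not form a function: an index may get several
   colours. *)
Definition lusin_cond d (W : orderType d) (A : W -> set nat) : Type :=
  ({fset W * nat} * nat)%type.

(** * Order, density and chain condition of the forcing *)

Section LusinForcing.
Context d (W : orderType d) (A : W -> set nat).

HB.instance Definition _ :=
  Choice.copy (lusin_cond A) ({fset W * nat} * nat)%type.

Definition lusin_extends (q p : lusin_cond A) : Prop :=
  [/\ {subset p.1 <= q.1}, (p.2 <= q.2)%N
    & forall i j c, (i, c) \in p.1 -> (j, c) \in q.1 -> (j, c) \notin p.1 ->
        j < i -> `I_(p.2) #<= A i `&` A j].

Let le_cond (q p : lusin_cond A) := `[< lusin_extends q p >].

Fact lusin_extends_refl : reflexive le_cond.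
Proof. by move=> p; apply/asboolP; split=> // i j c _ ->. Qed.

Fact lusin_extends_anti : antisymmetric le_cond.
Proof.
move=> [s m] [t n] /andP[/asboolP[/= ts nm _] /asboolP[/= st mn _]].
congr pair; last by apply/eqP; rewrite eqn_leq mn.
by apply/fsetP => x; apply/idP/idP => [/st|/ts].
Qed.

Fact lusin_extends_trans : transitive le_cond.
Proof.
move=> q p r /asboolP[qp qpn qpA] /asboolP[rq rqn rqA].
apply/asboolP; split=> [x /rq/qp//||i j c ir jp njr ji]; first exact: leq_trans qpn.
have [jq|njq] := boolP ((j, c) \in q.1); first exact: rqA ir jq njr ji.
by apply: card_le_trans (qpA i j c (rq _ ir) jp njq ji); rewrite card_le_II.
Qed.

Fact lusin_display : Order.disp_t. Proof. exact: Order.Disp tt tt. Qed.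

HB.instance Definition _ := Order.Le_isPOrder.Build lusin_display (lusin_cond A)
  lusin_extends_refl lusin_extends_anti lusin_extends_trans.

Lemma lusin_leP (q p : lusin_cond A) : reflect (lusin_extends q p) (q <= p).
Proof. exact: asboolP. Qed.

Lemma dense_lusin_cond (i : W) (n : nat) :
  poset_dense [set p : lusin_cond A | (exists c, (i, c) \in p.1) /\ (n <= p.2)%N].
Proof.
(* A fresh colour, so that no promise concerns the new pair. *)
move=> p; pose c := (\max_(x <- p.1) x.2).+1.
exists ((i, c) |` p.1, maxn n p.2)%fset.
  by split; [exists c; rewrite /= !inE eqxx|rewrite leq_maxl].
apply/lusin_leP; split=> [x xp||a b c' ap]; rewrite /= ?inE ?xp ?orbT//.
  exact: leq_maxr.
move=> /predU1P[[_ cc]|-> //].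
by have := @leq_bigmax_seq _ (enum_fset p.1) xpredT snd (a, c') ap isT; rewrite /= cc ltnn.
Qed.

Lemma ccc_lusin_cond : is_omega1 W -> inseparable A -> ccc (lusin_cond A).
Proof.
move=> W_omega1 A_insep D Danti; apply: contrapT => Dunc.
have [[k n] D1unc] := uncountable_fiber (fun p => (#|` p.1|, p.2)) Dunc.
set D1 := [set p | _] in D1unc.
have [|R [D2unc R_max]] := maximal_root (f := fst) (k := k) D1unc.
  by move=> p [_ []].
set D2 := [set p | _] in D2unc.
have D2P p : D2 p -> [/\ D p, p.2 = n, {subset R <= p.1}
    & #|` (p.1 `\` R)%fset| = (k - #|` R|)%N].
  move=> [[Dp [pk pn]] /[dup] Rp /fsubsetP]; split=> //.
  by rewrite cardfsDS// pk.
have [w0 _] : [set: W] !=set0 by apply: uncountable_nonempty; case: W_omega1.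
have D2_ctbl (Y : set W) : countable Y ->
    countable [set p | D2 p /\ exists2 a, a \in (p.1 `\` R)%fset & Y a.1].
  move=> Yc; have : countable (\bigcup_(a in [set a : W * nat | Y a.1 /\ a \notin R])
      [set p | [/\ D1 p, (R `<=` p.1)%fset & a \in p.1]]).
    apply: bigcup_countable => [|a [_ aR]]; last exact: R_max.
    apply: (@sub_countable _ _ _ (Y `*` [set: nat])); last exact: countableX.
    by apply: subset_card_le => a [].
  apply/sub_countable/subset_card_le => p [[D1p Rp] [a]].
  by rewrite inE => /andP[aR ap] Ya; exists a.
pose x l (p : lusin_cond A) := (nth (w0, 0) (p.1 `\` R)%fset l).1.
have xP p a : D2 p -> a \in (p.1 `\` R)%fset ->
    exists2 l, (l < k - #|` R|)%N & x l p = a.1.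
  move=> /D2P[_ _ _ <-] aS; exists (index a (p.1 `\` R)%fset); first by rewrite index_mem.
  by rewrite /x nth_index.
have [|N Nc NP] := large_intersections A_insep (k := k - #|` R|) (x := x) _ n D2unc.
  move=> w; apply: sub_countable (D2_ctbl [set w] (countable1 w)).
  apply: subset_card_le => p [D2p [l lk xl]]; split=> //.
  exists (nth (w0, 0) (p.1 `\` R)%fset l) => //.
  by apply: mem_nth; case: (D2P p D2p) => _ _ _ ->.
pose below (s : {fset W * nat}) := [set j | exists2 a, a \in s & j <= a.1].
have below_ctbl s : countable (below s).
  have : countable [set i | exists2 c, (fst @` [set` s]) c & i <= c].
    by apply: countable_below => //; apply/countable_image/countable_fset.
  apply/sub_countable/subset_card_le => j [a aS ja].
  by exists a.1.
have [p [D2p nNp]] := uncountable_nonempty (uncountable_setD D2unc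
  (countable_setU Nc (D2_ctbl _ (below_ctbl R)))).
have [|S SD2 [Sunc SA]] := NP p D2p; first by move=> Np; apply: nNp; left.
have [q [Sq nq]] := uncountable_nonempty (uncountable_setD Sunc
  (countable_setU (countable1 p) (D2_ctbl _ (below_ctbl p.1)))).
have D2q := SD2 q Sq.
have [Dp pn Rp _] := D2P p D2p; have [Dq qn Rq _] := D2P q D2q.
have npq : p <> q by move=> pq; apply: nq; left.
apply: (Danti p q Dp Dq npq); exists ((p.1 `|` q.1)%fset, n).
have offR (s : {fset W * nat}) a : a \in s -> a \notin R -> a \in (s `\` R)%fset.
  by rewrite inE => -> ->.
split; apply/lusin_leP; split=> /=.
- by move=> a ap; rewrite inE ap.
- by rewrite pn.
- move=> i j c ip; rewrite inE => /orP[->//|jq] jp ji; case: nq; right; split=> //.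
  exists (j, c); first by apply: offR => //; apply: contra jp => /Rp.
  by exists (i, c) => //; exact: ltW.
- by move=> a aq; rewrite inE aq orbT.
- by rewrite qn.
- move=> i j c iq; rewrite inE => /orP[jp|->//] jq ji.
  have jR : (j, c) \notin R by apply: contra jq => /Rq.
  have [iR|iR] := boolP ((i, c) \in R).
    case: nNp; right; split=> //; exists (j, c); first exact: offR.
    by exists (i, c) => //; exact: ltW.
  have [l lk xl] := xP p _ D2p (offR _ _ jp jR).
  have [l' l'k xl'] := xP q _ D2q (offR _ _ iq iR).
  by rewrite qn setIC -[j]xl -[i]xl'; exact: SA.
Qed.

End LusinForcing.

Section MartinAxiomLusin.
Context d (W : orderType d) (W_omega1 : is_omega1 W).

Lemma omega1_lt_continuum T (F : W -> T) : ~ CH -> card_lt (range F) [set: set nat].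
Proof.
move=> /existsNP[S /not_orP[/(omega1_card_le W_omega1) WS nSP]].
have FS : range F #<= S := card_le_trans (card_image_le _ _) WS.
split=> [|PF]; first exact: card_le_trans FS (card_leT S).
by apply: nSP; rewrite card_eq_le card_leT (card_le_trans PF FS).
Qed.

Lemma omega1_surj_nat : exists h : W -> nat, range h = setT.
Proof.
have /infiniteP/pfcard_geP[|[h]] : infinite_set [set: W].
- by move=> /finite_set_countable; case: W_omega1.
- by move=> /seteqP[/(_ 0 I)].
- by exists h; rewrite (image_eq h).
Qed.

Theorem MA_inseparable_lusin_star (A : W -> set nat) :
  MartinAxiom -> ~ CH -> inseparable A ->
  exists I : nat -> set W,
    \bigcup_k I k = [set: W] /\ forall k : nat, lusin_star A (I k).
Proof.
move=> MA nCH A_insep; have [h rh] := omega1_surj_nat.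
pose D i := [set p : lusin_cond A | (exists c, (i, c) \in p.1) /\ (h i <= p.2)%N].
have [||G [_ _ Gdir] GD] := MA _ (lusin_cond A) _ (ccc_lusin_cond W_omega1 A_insep)
    (range D) (omega1_lt_continuum D nCH).
- by exists (fset0, 0).
- by move=> _ [i _ <-]; exact: dense_lusin_cond.
have GDi i : exists2 p, G p & D i p by have [|p [Gp Dp]] := GD (D i); [|exists p].
exists (fun c => [set i | exists2 p : lusin_cond A, G p & (i, c) \in p.1]); split.
  apply/seteqP; split=> // i _.
  by have [p Gp [[c ic] _]] := GDi i; exists c => //; exists p.
move=> c i [p Gp ip] n.
have [w _ hw] : range h n by rewrite rh.
have [p' Gp' [_ np']] := GDi w.
have [r Gr [/lusin_leP[rp _ _] /lusin_leP[_ rp' _]]] := Gdir p p' Gp Gp'.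
have {np' rp'} nr : (n <= r.2)%N by rewrite -hw; apply: leq_trans rp'.
apply: (@sub_finite_set _ _ (fst @` [set` r.1])); last first.
  exact/finite_image/finite_fset.
move=> j [[q Gq jq] ji [_ nij]].
have [jr|njr] := boolP ((j, c) \in r.1); first by exists (j, c).
have [s _ [/lusin_leP[_ _ sr] /lusin_leP[sq _ _]]] := Gdir r q Gr Gq.
case: nij; apply: card_le_trans (sr i j c (rp _ ip) (sq _ jq) njr ji).
by rewrite card_le_II.
Qed.

End MartinAxiomLusin.

Theorem theorem1 (d : Order.disp_t) (W : orderType d) (W_omega1 : is_omega1 W) :
  (CH ->
     exists A : W -> set nat,
       [/\ pairwise_almost_disjoint A,
           inseparable A
         & ~ exists I : set W, ~ countable I /\ lusin A I])
  /\
  (MartinAxiom -> ~ CH ->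
     forall A : W -> set nat,
       pairwise_almost_disjoint A -> inseparable A ->
       exists I : nat -> set W,
         \bigcup_k I k = [set: W] /\ forall k : nat, lusin_star A (I k)).
Proof.
split; first exact: CH_inseparable_no_lusin.
by move=> MA nCH A _; exact: MA_inseparable_lusin_star.
Qed.
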